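(* Let $f$ be a function having a primitive on an interval $I\subseteq\mathbb{R}$ and let $n\ge 1$ be an integer. Then, on $I$, $$\int f(x)\cdots\int f(x)\int f(x)\,dx^n=\frac{1}{n!}\left(\int f(x)\,dx\right)^n+\sum_{i=0}^{n-1}c_i\frac{1}{i!}\left(\int f(x)\,dx\right)^i,$$ where $c_0,\dots,c_{n-1}$ are arbitrary constants of integration. That is, for any fixed choice of primitive $F=\int f(x)\,dx$ on $I$, the $n$-th order indefinite recurrent integrals of $f$ are exactly the functions $\frac{F^n}{n!}+\sum_{i=0}^{n-1}c_i\frac{F^i}{i!}$ with $c_0,\dots,c_{n-1}$ arbitrary constants.
   Context: The indefinite recurrent integral of order $n$ of $f$, written $J_n=\int f(x)\int f(x)\cdots\int f(x)\,dx^n$ ($n$ integral signs), is defined recursively by $J_0=1$ and $J_{n+1}=\int f(x)J_n\,dx$, each integration introducing an arbitrary constant; so it is the family of all functions $g_n$ for which there are functions $g_0=1,g_1,\dots,g_n$ on $I$ with $g_{j+1}'=f\,g_j$ for $0\le j<n$. Convention: $F^0=1$. *)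

(* Defs.v *)
From Stdlib Require Import Reals.
Open Scope R_scope.

Definition is_interval (I : R -> Prop) : Prop :=
  forall x y z : R, I x -> I y -> x <= z <= y -> I z.

(* Functions on I are total functions of which only the values on I matter.
   [D_in] takes the limit of the difference quotient along points of I, so the
   derivative is one-sided at an endpoint of I that belongs to I. *)
Definition is_primitive (I : R -> Prop) (f F : R -> R) : Prop :=
  forall x : R, I x -> D_in F f I x.

(* The indefinite recurrent integral J_n as a family of functions: every
   integration picks an arbitrary primitive. *)
Fixpoint recurrent_integral (I : R -> Prop) (f : R -> R) (n : nat)
    (g : R -> R) : Prop :=
  match n with
  | O => forall x : R, I x -> g x = 1
  | S m => exists h : R -> R,
      recurrent_integral I f m h /\ is_primitive I (fun x => f x * h x) g
  end.

(* Main.v *)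
Require Import Defs.
From Stdlib Require Import Arith Reals Lra Lia.
Open Scope R_scope.

(** Fix a primitive [F]. With coefficients [c 0, ..., c n], the function
    [sum_(i <= n) c i * F^i / i!] has derivative
    [f * sum_(i < n) c (i + 1) * F^i / i!]: differentiation shifts the
    coefficient sequence. As two primitives on an interval differ by a constant,
    integrating shifts it back and makes the coefficient of index 0 arbitrary.
    So, by induction on [n], the [n]-th recurrent integrals are the sums whose
    coefficient of index [n] is 1 (the one [J_0 = 1] starts with) and whose other
    coefficients are arbitrary. *)

(** The difference quotients in [D_in] only involve values of [u] on [D], and [du] enters only at
    [x]. *)
Lemma D_in_ext (D : R -> Prop) (u v du dv : R -> R) (x : R) :
  D x -> (forall y, D y -> u y = v y) -> du x = dv x ->
  D_in u du D x -> D_in v dv D x.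
Proof.
  intros Hx Huv Hd Hu e He.
  destruct (Hu e He) as [a [Ha Hl]].
  exists a; split; [exact Ha|].
  intros y Hy; rewrite <- Hd, <- (Huv x Hx), <- (Huv y (proj1 (proj1 Hy))).
  exact (Hl y Hy).
Qed.

Lemma D_in_pow (D : R -> Prop) (u du : R -> R) (x : R) (n : nat) :
  D x -> D_in u du D x ->
  D_in (fun y => u y ^ S n) (fun y => INR (S n) * u y ^ n * du y) D x.
Proof.
  intros Hx Hu; induction n as [|n IH].
  - apply (D_in_ext D u _ du); trivial; intros; simpl; ring.
  - refine (D_in_ext _ _ _ _ _ _ Hx _ _ (Dmult D _ _ _ _ x Hu IH)).
    + intros; reflexivity.
    + rewrite (S_INR (S n)); simpl pow; ring.
Qed.

(** Increments smaller than the distance from [x] to [a] and [b] stay in [D], so the limit along [D]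
    is two-sided. *)
Lemma D_in_interior (D : R -> Prop) (u du : R -> R) (a b x : R) :
  (forall y, a <= y <= b -> D y) -> a < x < b ->
  D_in u du D x -> derivable_pt_lim u x (du x).
Proof.
  intros HD Hx Hu e He.
  destruct (Hu e He) as [r [Hr Hl]].
  assert (Hm : 0 < Rmin r (Rmin (x - a) (b - x))).
  { repeat apply Rmin_glb_lt; lra. }
  exists (mkposreal _ Hm); simpl; intros h Hh0 Hh.
  assert (H1 : Rabs h < r) by (eapply Rlt_le_trans; [exact Hh | apply Rmin_l]).
  assert (H2 : Rabs h < Rmin (x - a) (b - x))
    by (eapply Rlt_le_trans; [exact Hh | apply Rmin_r]).
  assert (H3 : Rabs h < x - a) by (eapply Rlt_le_trans; [exact H2 | apply Rmin_l]).
  assert (H4 : Rabs h < b - x) by (eapply Rlt_le_trans; [exact H2 | apply Rmin_r]).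
  apply Rabs_def2 in H3; apply Rabs_def2 in H4.
  specialize (Hl (x + h)); simpl in Hl; unfold Rdist in Hl.
  replace (x + h - x) with h in Hl by ring.
  apply Hl; repeat split; trivial; [apply HD|]; lra.
Qed.

Lemma D_in_zero_eq (D : R -> Prop) (u : R -> R) (a b : R) :
  (forall y, a <= y <= b -> D y) -> a < b ->
  (forall x, D x -> D_in u (fun _ => 0) D x) -> u a = u b.
Proof.
  intros HD Hab Hu.
  (* [u] need not be continuous at [a] and [b] from outside [D], so [MVT] is
     applied to [u] precomposed with the retraction of R onto [a, b]. *)
  set (p := fun x => Rmax a (Rmin b x)).
  assert (Hp : forall x, a <= p x <= b).
  { intros x; unfold p, Rmax, Rmin.
    destruct (Rle_dec b x); destruct (Rle_dec a _); lra. }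
  assert (Hid : forall x, a <= x <= b -> p x = x).
  { intros x Hx; unfold p, Rmax, Rmin.
    destruct (Rle_dec b x); destruct (Rle_dec a _); lra. }
  assert (Hlip : forall x y, Rabs (p y - p x) <= Rabs (y - x)).
  { intros x y; unfold p, Rmax, Rmin, Rabs.
    destruct (Rle_dec b x); destruct (Rle_dec b y);
      repeat destruct (Rle_dec a _); repeat destruct (Rcase_abs _); lra. }
  set (v := fun x => u (p x)).
  assert (Hder : forall x, a < x < b -> derivable_pt_lim v x 0).
  { intros x Hx.
    assert (Hxu := D_in_interior D u _ a b x HD Hx (Hu x (HD x ltac:(lra)))).
    apply (derivable_pt_lim_locally_ext u v x a b 0 Hx); trivial.
    intros z Hz; unfold v; rewrite Hid; [reflexivity | lra]. }
  (* With 0 as explicit witness, [derive_pt v x (pr x Hx)] computes to 0, which [eq_refl] proves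
     below. *)
  set (pr := fun x Hx => exist (derivable_pt_lim v x) 0 (Hder x Hx)
             : derivable_pt v x).
  assert (Hcont : forall x, a <= x <= b -> continuity_pt v x).
  { intros x Hx e He.
    destruct (cont_deriv u _ D x (Hu x (HD x Hx)) e He) as [r [Hr Hl]].
    exists r; split; trivial.
    intros y [_ Hy]; simpl in *; unfold v, Rdist in *.
    rewrite (Hid x Hx).
    (* The limit from [cont_deriv] excludes the point [x] itself, but [p y = x] does occur when [x]
       is an endpoint and [y] lies beyond it. *)
    destruct (Req_dec x (p y)) as [<-|Hne]; [rewrite Rminus_diag, Rabs_R0; lra|].
    apply Hl; split; [split; [apply HD, Hp | exact Hne]|].
    rewrite <- (Hid x Hx); eapply Rle_lt_trans; [apply Hlip | exact Hy]. }
  assert (Hc := null_derivative_loc v a b pr Hcont (fun x Hx => eq_refl)).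
  assert (H := Hc b ltac:(lra)); unfold v in H.
  rewrite !Hid in H by lra; auto.
Qed.

Lemma primitive_unique (I : R -> Prop) (f G H : R -> R) :
  is_interval I -> is_primitive I f G -> is_primitive I f H ->
  exists k : R, forall x, I x -> G x = k + H x.
Proof.
  intros hI hG hH.
  assert (Hz : forall x, I x -> D_in (fun y => G y - H y) (fun _ => 0) I x).
  { intros x Hx.
    refine (D_in_ext _ _ _ _ _ _ Hx _ _ (Dminus I _ _ _ _ x (hG x Hx) (hH x Hx))).
    - reflexivity.
    - simpl; ring. }
  (* The constant is read off at a point of [I]; if [I] is empty, any constant works. *)
  destruct (Classical_Prop.classic (exists a, I a)) as [[a Ha]|Hno].
  - exists (G a - H a); intros x Hx.
    enough (G a - H a = G x - H x) by lra.
    destruct (Rtotal_order a x) as [Hl|[->|Hl]]; [|reflexivity|symmetry];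
      apply (D_in_zero_eq I (fun y => G y - H y)); trivial;
      intros y Hy; [apply (hI a x) | apply (hI x a)]; trivial.
  - exists 0; intros x Hx; exfalso; apply Hno; eauto.
Qed.

Definition exp_poly (c : nat -> R) (n : nat) (t : R) : R :=
  sum_f_R0 (fun i => c i * (1 / INR (fact i)) * t ^ i) n.

(** Term by term: the factor [i + 1] from differentiating [F ^ (i + 1)] cancels against [(i + 1)!],
    and the constant term vanishes. *)
Lemma exp_poly_primitive (I : R -> Prop) (f F : R -> R) (c : nat -> R) (n : nat) :
  is_primitive I f F ->
  is_primitive I (fun x => f x * exp_poly (fun i => c (S i)) n (F x))
    (fun x => exp_poly c (S n) (F x)).
Proof.
  intros hF x Hx.
  assert (Hterm : forall i, D_in (fun y => c (S i) * (1 / INR (fact (S i))) * F y ^ S i)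
            (fun y => f y * (c (S i) * (1 / INR (fact i)) * F y ^ i)) I x).
  { intros i.
    refine (D_in_ext _ _ _ _ _ _ Hx _ _
      (Dmult_const I _ _ x (c (S i) * (1 / INR (fact (S i))))
         (D_in_pow I F f x i Hx (hF x Hx)))); [reflexivity|].
    rewrite fact_simpl, mult_INR; field.
    split; [apply INR_fact_neq_0 | apply not_0_INR; lia]. }
  unfold exp_poly; induction n as [|n IH].
  - refine (D_in_ext _ _ _ _ _ _ Hx _ _
      (Dadd I _ _ _ _ x (Dconst I (c 0%nat * (1 / INR (fact 0)) * 1) x) (Hterm 0%nat))).
    + reflexivity.
    + simpl; ring.
  - refine (D_in_ext _ _ _ _ _ _ Hx _ _ (Dadd I _ _ _ _ x IH (Hterm (S n)))).
    + reflexivity.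
    + rewrite (tech5 _ n); ring.
Qed.

(** This absorbs a constant of integration into the coefficients: [k] occurs only at index 0, where
    it contributes [k / 0! = k]. *)
Lemma exp_poly_shift (k : R) (c : nat -> R) (n : nat) (t : R) :
  exp_poly (fun i => match i with O => k | S j => c j end) n t
  = k + exp_poly (fun i => match i with O => 0 | S j => c j end) n t.
Proof.
  unfold exp_poly; induction n as [|n IH]; [simpl; field|].
  rewrite !tech5, IH; ring.
Qed.

(** Keeping the leading term in the sum, as [c n = 1], lets the induction start at [n = 0] and makes
    its step a pure index shift. *)
Lemma recurrent_integral_exp_poly (I : R -> Prop) (f F : R -> R) :
  is_interval I -> is_primitive I f F ->
  forall (n : nat) (g : R -> R),
  recurrent_integral I f n g <->
  exists c : nat -> R, c n = 1 /\ forall x, I x -> g x = exp_poly c n (F x).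
Proof.
  intros hI hF; induction n as [|n IH]; intros g; simpl recurrent_integral.
  - split.
    + intros Hg; exists (fun _ => 1); split; [reflexivity|].
      intros x Hx; rewrite (Hg x Hx); unfold exp_poly; simpl; field.
    + intros [c [Hc Hg]] x Hx; rewrite (Hg x Hx); unfold exp_poly; simpl.
      rewrite Hc; field.
  - split.
    + intros [h [Hh Hg]].
      apply IH in Hh; destruct Hh as [c [Hc Hh]].
      (* The primitive with constant term 0 serves as reference; [g] differs from it by some [k]. *)
      set (c0 := fun i => match i with O => 0 | S j => c j end).
      assert (HP : is_primitive I (fun x => f x * h x)
                     (fun x => exp_poly c0 (S n) (F x))).
      { intros x Hx.
        refine (D_in_ext _ _ _ _ _ _ Hx _ _ (exp_poly_primitive I f F c0 n hF x Hx)).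
        - reflexivity.
        - simpl; rewrite (Hh x Hx); reflexivity. }
      destruct (primitive_unique I _ g _ hI Hg HP) as [k Hk].
      exists (fun i => match i with O => k | S j => c j end); split; [exact Hc|].
      intros x Hx; rewrite (Hk x Hx), exp_poly_shift; reflexivity.
    + intros [c [Hc Hg]].
      (* Differentiation forgets [c 0] and moves the coefficient 1 from index [S n] to index [n]. *)
      exists (fun x => exp_poly (fun i => c (S i)) n (F x)); split.
      * apply IH; exists (fun i => c (S i)); auto.
      * intros x Hx.
        refine (D_in_ext _ _ _ _ _ _ Hx _ _ (exp_poly_primitive I f F c n hF x Hx)).
        -- intros y Hy; symmetry; auto.
        -- reflexivity.
Qed.

Theorem theorem2p5 (I : R -> Prop) (f F : R -> R) (n : nat)
  (hI : is_interval I) (hn : (1 <= n)%nat) (hF : is_primitive I f F)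
  (g : R -> R) :
  recurrent_integral I f n g <->
  exists c : nat -> R, forall x : R, I x ->
    g x = 1 / INR (fact n) * F x ^ n
          + sum_f_R0 (fun i : nat => c i * (1 / INR (fact i)) * F x ^ i) (n - 1).
Proof.
  rewrite (recurrent_integral_exp_poly I f F hI hF).
  (* [hn] rules out [n = 0], where the truncated [n - 1] would leave a spurious term of index 0. *)
  destruct n as [|m]; [lia|].
  replace (S m - 1)%nat with m by lia.
  split.
  - intros [c [Hc Hg]]; exists c; intros x Hx.
    rewrite (Hg x Hx); unfold exp_poly; rewrite tech5, Hc; ring.
  - intros [c Hg].
    (* The sum stops at index [m], so the value of [c] at [S m] is free and can be reset to 1. *)
    exists (fun i => if Nat.eq_dec i (S m) then 1 else c i); split.
    + destruct (Nat.eq_dec (S m) (S m)); congruence.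
    + intros x Hx; rewrite (Hg x Hx); unfold exp_poly; rewrite tech5.
      destruct (Nat.eq_dec (S m) (S m)) as [_|]; [|congruence].
      rewrite Rplus_comm, Rmult_1_l; f_equal.
      apply sum_eq; intros i Hi.
      destruct (Nat.eq_dec i (S m)); [lia | reflexivity].
Qed.
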